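(* For any $\varepsilon>0$ and any integer $d\geq 2$ there exist positive constants $c_1$ and $c_2$ depending only on $d$ and $\varepsilon$ such that for every prime $p$ the following holds. If $f\in\mathbb{F}_p[X]$ is of degree at most $d$, $\mathscr{P}_0\geq c_1$, $u\in\mathbb{F}_p$, and $N\ge 1$ is an integer with $N<T_u$, then $$ G(N)\geq c_2\min\left\{N^{2-\varepsilon},\, p^{1-\varepsilon}\right\}. $$
   Context: Let $p$ be a prime, $\mathbb{F}_p$ the field of $p$ elements and $f\in\mathbb{F}_p[X]$. For $u\in\mathbb{F}_p$ let $(u_n)_{n\ge0}$ be the sequence $u_0=u$, $u_{n+1}=f(u_n)$ for $n=0,1,2,\ldots$. The trajectory length $T_u$ is the smallest integer $t$ for which there is an integer $s$ with $0\leq s<t$ and $u_s=u_t$. For $v\in\mathbb{F}_p$, $\mathscr{P}_v$ is the period length of the sequence with starting point $v$: the minimal integer $m>0$ such that $u_n=u_{n+m}$ for all $n=0,1,\ldots$ (where $u_0=v$), with $\mathscr{P}_v=\infty$ if the sequence is not purely periodic (only eventually periodic). In particular $\mathscr{P}_0$ is this quantity for the starting point $v=0$. $G(N)$ (depending also on $u$ and $f$) is the size of the smallest subgroup $\mathcal{G}\subseteq\mathbb{F}_p^*$ which contains the non-zero elements among $u_1,\ldots,u_N$, i.e. $u_n\in\mathcal{G}\cup\{0\}$ for $n=1,\ldots,N$. *)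

(* Defs.v *)
From HB Require Import structures.
From mathcomp Require Import all_boot all_order all_algebra all_fingroup.
From mathcomp Require Import all_classical all_reals all_analysis.

Set Implicit Arguments.
Unset Strict Implicit.
Unset Printing Implicit Defensive.

Import Order.TTheory GRing.Theory Num.Theory.

Local Open Scope ring_scope.

Section PolynomialOrbits.
Variables (p : nat) (f : {poly 'F_p}).

Definition poly_orbit (u : 'F_p) (n : nat) : 'F_p := iter n (horner f) u.

Lemma poly_orbit_repeats (u : 'F_p) :
  exists t, [exists s : 'I_t, poly_orbit u s == poly_orbit u t].
Proof.
pose m := #|'F_p|.+1; pose g (i : 'I_m) := poly_orbit u i.
have /injectivePn [i [j ij gij]] : ~~ injectiveb g.
  by apply/negP => /injectiveP /leq_card; rewrite card_ord ltnn.
wlog lt_ij : i j ij gij / (i < j)%N => [H|].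
  have := ij; rewrite -val_eqE neq_ltn => /orP[]; first exact: H.
  by apply: H; rewrite // eq_sym.
by exists j; apply/existsP; exists (Ordinal lt_ij); apply/eqP.
Qed.

Definition trajectory_length (u : 'F_p) : nat := ex_minn (poly_orbit_repeats u).

(* The infimum is over a set of positive integers, hence it is a minimum,
   unless the set is empty: then it is +oo, as wanted for an orbit that is not
   purely periodic. *)
Definition orbit_period (R : realType) (v : 'F_p) : \bar R :=
  ereal_inf [set (m%:R)%:E | m in
    [set m : nat | (0 < m)%N /\
       forall n, poly_orbit v n = poly_orbit v (n + m)%N]]%classic.

Definition orbit_group (u : 'F_p) (N : nat) : {group {unit 'F_p}} :=
  <<[set x : {unit 'F_p} |
      [exists n : 'I_N.+1, (0 < n)%N && (val x == poly_orbit u n)]]>>%G.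

Definition orbit_group_size (u : 'F_p) (N : nat) : nat := #|orbit_group u N|.

End PolynomialOrbits.

Arguments orbit_period {p} f R v.

(* Main.v *)
(* Stepanov's method. If [x], [f x], ..., [f^(K-1) x] all lie in a group of
   order [t], then [psi_b := prod_i (f^i)^(t * b_i)] takes the value 1 at [x] for
   every exponent vector [b]. The iterates [f^i] are pairwise coprime because
   the orbit of 0 does not return to 0 early. With [Phi := prod_i f^i], each
   iterate of the derivation [Phi d/dx] acts on [psi_b q] as [psi_b] times an
   operator on [q] that raises degrees by at most [deg Phi]. So there are two
   ways to bound the set [S] of such points:
   - if the products [x^a psi_b] ([a < D], [b_i < B]) are linearly independent,
     linear algebra gives a nonzero combination vanishing to order [D] on [S];
   - otherwise a shortest relation [sum_b P_b psi_b = 0], differentiated fewer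
     than [B^K] times and read at [psi_b = 1], gives a polynomial of low degree
     vanishing on [S], and it is nonzero for some number of derivatives because
     the Wronskian of linearly independent polynomials is nonzero.
   Taking [D] about [B^K] and [B] about [t^(1/(2K-1))] yields
   [|S| = O(t^(K/(2K-1)))], as long as all degrees stay below [p], which fails
   only when [p = O(t^(2K/(2K-1)))]. *)

Require Import Defs.
From HB Require Import structures.
From mathcomp Require Import all_boot all_order all_algebra all_fingroup.
From mathcomp Require Import all_classical all_reals all_analysis.
From mathcomp Require Import cyclic zify ring.

Set Implicit Arguments.
Unset Strict Implicit.
Unset Printing Implicit Defensive.

Import Order.TTheory GRing.Theory Num.Theory.

Local Open Scope ring_scope.

(** * Derivations [a d/dx] and Wronskians in characteristic [p] *)

Definition scaled_deriv (F : fieldType) (a q : {poly F}) : {poly F} := a * q^`().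

Lemma scaled_derivM (F : fieldType) (a q r : {poly F}) :
  scaled_deriv a (q * r) = scaled_deriv a q * r + q * scaled_deriv a r.
Proof. by rewrite /scaled_deriv derivM; ring. Qed.

Lemma scaled_deriv_sum (F : fieldType) (a : {poly F}) (I : finType)
    (P : pred I) (q : I -> {poly F}) :
  scaled_deriv a (\sum_(i | P i) q i) = \sum_(i | P i) scaled_deriv a (q i).
Proof. by rewrite /scaled_deriv raddf_sum mulr_sumr. Qed.

Lemma iter_scaled_deriv_sum (F : fieldType) (a : {poly F}) n (I : finType)
    (P : pred I) (q : I -> {poly F}) :
  iter n (scaled_deriv a) (\sum_(i | P i) q i)
  = \sum_(i | P i) iter n (scaled_deriv a) (q i).
Proof. by elim: n => //= n ->; rewrite scaled_deriv_sum. Qed.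

Lemma coef_deriv_eq0 (F : fieldType) p (q : {poly F}) i :
  p \in [pchar F] -> q^`() = 0 -> ~~ (p %| i)%N -> q`_i = 0.
Proof.
move=> pF q0; case: i => [|i] ndiv; first by rewrite dvdn0 in ndiv.
have /eqP := coef_deriv q i; rewrite q0 coef0 -mulr_natr eq_sym mulf_eq0.
by rewrite -(dvdn_pcharf pF) (negPf ndiv) orbF => /eqP.
Qed.

(* The first polynomials have exponents divisible by [p] only and the second
   ones degree less than [p], so that a relation can be read off one block of
   [p] consecutive coefficients. *)
Lemma lin_dep_of_deriv0 (F : fieldType) p (I : finType) (T : {set I})
    (f k : I -> {poly F}) i0 :
  p \in [pchar F] -> (forall i, i \in T -> (size (f i) <= p)%N) ->
  (forall i, i \in T -> (k i)^`() = 0) -> \sum_(i in T) k i * f i = 0 ->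
  i0 \in T -> k i0 != 0 ->
  exists2 c : I -> F, c i0 != 0 & \sum_(i in T) c i *: f i = 0.
Proof.
move=> pF szf k'0 sum0 i0T k0; pose s := (size (k i0)).-1.
have ks0 : (k i0)`_s != 0 by rewrite -lead_coefE lead_coef_eq0.
have ps : (p %| s)%N.
  by apply: contraNT ks0 => ndiv; rewrite (coef_deriv_eq0 pF) ?k'0.
exists (fun i => (k i)`_s) => //; apply/polyP => l; rewrite coef0 coef_sum.
have [lp|pl] := ltnP l p; last first.
  apply: big1 => i iT; rewrite coefZ [(f i)`_l]nth_default ?mulr0 //.
  exact: leq_trans (szf i iT) pl.
(* In coefficient [s + l] of [k i * f i] only the term [j = s] survives: any other multiple
   [j <= s + l] of [p] pairs with an index of [f i] that is at least [p]. *)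
rewrite -[RHS](coef0 _ (s + l)%N) -sum0 coef_sum; apply: eq_bigr => i iT.
have slt : (s < (s + l).+1)%N by rewrite ltnS leq_addr.
rewrite coefZ coefM (bigD1 (Ordinal slt)) //= addKn big1 ?addr0 // => j.
rewrite -val_eqE /= => js; have [pj|npj] := boolP (p %| j)%N; last first.
  by rewrite (coef_deriv_eq0 pF (k'0 i iT)) // mul0r.
have [lj|jl] := leqP (j + p) (s + l).
  rewrite [(f i)`_ _]nth_default ?mulr0 // (leq_trans (szf i iT)) //.
  by rewrite leq_subRL // (leq_trans _ lj) ?leq_addr.
case/eqP: js; have p0 : (0 < p)%N := prime_gt0 (pcharf_prime pF).
case/dvdnP: pj (ltn_ord j) jl => u ->; case/dvdnP: ps => v -> h1 h2.
have h : (u * p < v.+1 * p)%N by rewrite mulSn; lia.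
have h' : (v * p < u.+1 * p)%N by rewrite mulSn; lia.
by rewrite !ltn_pmul2r // !ltnS in h h'; congr (_ * _)%N; lia.
Qed.

(* Nonvanishing of the Wronskian of linearly independent polynomials, for the
   derivation [a d/dx]: the matrix of derivatives has no kernel. *)
Lemma wronskian_kernel (F : fieldType) p (a : {poly F}) (I : finType)
    (T : {set I}) (f g : I -> {poly F}) :
  p \in [pchar F] -> a != 0 -> (forall i, i \in T -> (size (f i) <= p)%N) ->
  (forall n, (n < #|T|)%N ->
     \sum_(i in T) g i * iter n (scaled_deriv a) (f i) = 0) ->
  (exists2 i, i \in T & g i != 0) ->
  exists2 c : I -> F, exists2 i, i \in T & c i != 0 &
    \sum_(i in T) c i *: f i = 0.
Proof.
move=> pF a0; have [m] := ubnP #|T|; elim: m => // m IH in T g *.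
rewrite ltnS => Tm szf rel [i0 i0T g0].
have T0 : (0 < #|T|)%N by apply/card_gt0P; exists i0.
(* Differentiating a relation and subtracting the next one gives a relation with coefficients
   [d (g i)]. Eliminating the term [i0] between it and the original one gives the coefficients
   [h i], at the cost of one order of differentiation. *)
pose d := scaled_deriv a; pose h i := g i0 * d (g i) - g i * d (g i0).
have d0 : d 0 = 0 by rewrite /d /scaled_deriv deriv0 mulr0.
have relh n : (n < #|T|.-1)%N -> \sum_(i in T) h i * iter n d (f i) = 0.
  move=> nT; have nT1 : (n.+1 < #|T|)%N by rewrite -(prednK T0) ltnS.
  have := congr1 d (rel n (ltnW nT1)).
  rewrite d0 /d scaled_deriv_sum => e.
  have {}e : \sum_(i in T) d (g i) * iter n d (f i) = 0.
    rewrite -[LHS]addr0 -[X in _ + X](rel _ nT1) -big_split /= -[RHS]e.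
    by apply: eq_bigr => i _; rewrite scaled_derivM.
  have := congr2 (fun x y => g i0 * x - d (g i0) * y) e (rel n (ltnW nT1)).
  rewrite !mulr0 subr0 !mulr_sumr -sumrB => e'; rewrite -[RHS]e'; apply: eq_bigr => i _.
  by rewrite /h; ring.
have h0 : h i0 = 0 by rewrite /h subrr.
have [/exists_inP[i iT hi]|/exists_inPn hT] := boolP [exists i in T, h i != 0].
  have cT : #|T :\ i0| = #|T|.-1 by rewrite (cardsD1 i0 T) i0T.
  have [||n nT||c [j jT cj] sumc] := IH (T :\ i0) h.
  - by rewrite cT -ltnS prednK.
  - by move=> j /setD1P[_]; apply: szf.
  - rewrite -[RHS](relh n); last by rewrite -cT.
    rewrite [RHS](bigD1 i0) //= h0 mul0r add0r; apply: eq_bigl => j.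
    by rewrite !inE andbC.
  - exists i => //; rewrite !inE iT andbT; apply: contraNneq hi => ->.
    by rewrite h0.
  move: jT; rewrite !inE => /andP[ji0 jT].
  exists (fun k => if k == i0 then 0 else c k).
    by exists j => //; rewrite (negPf ji0).
  rewrite (bigD1 i0) //= eqxx scale0r add0r -[RHS]sumc.
  apply: eq_big => [k|k /andP[_ /negPf ->]] //; by rewrite !inE andbC.
have p1 : (1 < p)%N := prime_gt1 (pcharf_prime pF).
(* All [h i] vanish, so each quotient [g i / g i0] has derivative 0. Multiplying it by the [p]-th
   power of [g i0] preserves this and clears the denominator. *)
pose k i := g i * g i0 ^+ p.-1.
have [|||c c0 sumc] := @lin_dep_of_deriv0 F p I T f k i0 pF szf _ _ i0T.
- move=> i iT; have := hT i iT; rewrite negbK.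
  have -> : h i = a * (g i0 * (g i)^`() - g i * (g i0)^`()).
    by rewrite /h /d /scaled_deriv; ring.
  rewrite mulf_eq0 (negPf a0) subr_eq0 => /eqP e.
  have [q pq] : exists q, p = q.+2 by exists p.-2; lia.
  rewrite /k derivM deriv_exp pq /= exprS mulrA [_^`() * g i0]mulrC e.
  have -> : g i * (g i0)^`() * g i0 ^+ q + g i * ((g i0)^`() * g i0 ^+ q *+ q.+1)
     = g i * (g i0)^`() * g i0 ^+ q * q.+2%:R by ring.
  have : q.+2 \in [pchar {poly F}] by rewrite -pq pchar_poly.
  by move/pcharf0 => ->; rewrite mulr0.
- transitivity (g i0 ^+ p.-1 * \sum_(i in T) g i * iter 0 d (f i)).
    by rewrite mulr_sumr; apply: eq_bigr => i _; rewrite /k /=; ring.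
  by rewrite rel ?mulr0.
- by rewrite /k mulf_neq0 ?expf_neq0.
by exists c => //; exists i0.
Qed.

(** * Products of powers and their twisted derivations *)

Section Products.
Variables (F : fieldType) (K B t : nat) (f : 'I_K -> {poly F}).
Hypothesis f_gt1 : forall i, (1 < size (f i))%N.

Definition all_prod : {poly F} := \prod_i f i.

Definition total_degree : nat := \sum_i (size (f i)).-1.

Definition power_prod (b : {ffun 'I_K -> 'I_B}) : {poly F} :=
  \prod_i f i ^+ (t * b i).

(** The logarithmic derivative of [power_prod b], multiplied by [all_prod] to make it a
    polynomial. *)
Definition log_deriv (b : {ffun 'I_K -> 'I_B}) : {poly F} :=
  \sum_i ((f i)^`() * \prod_(j | j != i) f j) *+ (t * b i).

(** The derivation [all_prod d/dx] conjugated by multiplication by [power_prod b]. *)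
Definition twisted_deriv (b : {ffun 'I_K -> 'I_B}) (q : {poly F}) : {poly F} :=
  all_prod * q^`() + log_deriv b * q.

Lemma factor_neq0 i : f i != 0.
Proof. by rewrite -size_poly_gt0 ltnW. Qed.

Lemma all_prod_neq0 : all_prod != 0.
Proof. by apply/prodf_neq0 => i _; apply: factor_neq0. Qed.

Lemma power_prod_neq0 b : power_prod b != 0.
Proof. by apply/prodf_neq0 => i _; rewrite expf_neq0 ?factor_neq0. Qed.

Lemma deriv_power_prod b :
  scaled_deriv all_prod (power_prod b) = power_prod b * log_deriv b.
Proof.
rewrite /power_prod /log_deriv.
elim/big_rec2: _ => [|i tau q _ IH].
  by rewrite /scaled_deriv derivC !mulr0.
rewrite scaled_derivM IH.
suff -> : scaled_deriv all_prod (f i ^+ (t * b i)) =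
    f i ^+ (t * b i) * (((f i)^`() * \prod_(j | j != i) f j) *+ (t * b i)).
  by ring.
rewrite /scaled_deriv deriv_exp /all_prod (bigD1 i) //=.
by case: (t * b i)%N => [|e] /=; rewrite ?mulr0n ?mulr0 // exprS; ring.
Qed.

Lemma iter_scaled_deriv_power b n q :
  iter n (scaled_deriv all_prod) (power_prod b * q)
  = power_prod b * iter n (twisted_deriv b) q.
Proof.
elim: n => //= n ->; rewrite scaled_derivM deriv_power_prod.
by rewrite /twisted_deriv /scaled_deriv; ring.
Qed.

Lemma size_all_prod : size all_prod = total_degree.+1.
Proof.
rewrite size_prod => [|i _]; last exact: factor_neq0.
rewrite /total_degree -sum1_card.
suff -> : (\sum_i size (f i) = \sum_i (size (f i)).-1 + \sum_(i < K) 1)%N.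
  by rewrite -addSn addnK.
by rewrite -big_split; apply: eq_bigr => i _; rewrite /= addn1 prednK // ltnW.
Qed.

Lemma size_log_deriv b : (size (log_deriv b) <= total_degree.+1)%N.
Proof.
apply: (leq_trans (size_sum _ _ _)); apply/bigmax_leqP => i _.
rewrite -mulr_natr -polyC1 -polyCMn mulrC mul_polyC.
apply: (leq_trans (size_scale_leq _ _)).
apply: (leq_trans (size_polyMleq _ _)); rewrite -size_all_prod.
rewrite /all_prod [in leqRHS](bigD1 i) //= size_mul ?factor_neq0 //; last first.
  by apply/prodf_neq0 => j _; apply: factor_neq0.
by rewrite -!subn1 leq_sub2r // leq_add2r; apply: ltnW (lt_size_deriv (factor_neq0 i)).
Qed.

(** The growth does not depend on [t] or [B], whereas the degree of [power_prod b] does; the method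
    gains from this difference. *)
Lemma size_twisted_deriv b q :
  (size (twisted_deriv b q) <= size q + total_degree)%N.
Proof.
apply: (leq_trans (size_polyD _ _)); rewrite geq_max.
have [->|/lt_size_deriv /ltnW h] := eqVneq q 0.
  by rewrite deriv0 !mulr0 size_poly0.
have sz (r1 r2 : {poly F}) : (size r1 <= total_degree.+1)%N -> (size r2 <= size q)%N ->
    (size (r1 * r2)%R <= size q + total_degree)%N.
  move=> h1 h2; apply: (leq_trans (size_polyMleq _ _)).
  by rewrite -subn1 leq_subLR (leq_trans (leq_add h1 h2)) // addSn add1n ltnS addnC.
by rewrite !sz ?size_all_prod ?size_log_deriv.
Qed.

Lemma size_iter_twisted_deriv b n q :
  (size (iter n (twisted_deriv b) q) <= size q + n * total_degree)%N.
Proof.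
elim: n => [|n IH] /=; first by rewrite mul0n addn0.
apply: (leq_trans (size_twisted_deriv _ _)).
by rewrite mulSn addnCA [leqRHS]addnC leq_add2r.
Qed.

Lemma iter_twisted_deriv_sum b n (J : finType) (c : J -> F)
    (q : J -> {poly F}) :
  iter n (twisted_deriv b) (\sum_j c j *: q j)
  = \sum_j c j *: iter n (twisted_deriv b) (q j).
Proof.
elim: n => //= n ->; rewrite /twisted_deriv raddf_sum !mulr_sumr -big_split /=.
by apply: eq_bigr => j _; rewrite derivZ scalerDr !scalerAr.
Qed.

Lemma size_power_prod b : (size (power_prod b) <= (t * B * total_degree).+1)%N.
Proof.
rewrite size_prod => [|i _]; last by rewrite expf_neq0 ?factor_neq0.
rewrite leq_subLR -sum1_card addnS ltnS /total_degree big_distrr -big_split /=.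
apply: leq_sum => i _.
rewrite /= add1n (leq_trans (leqSpred _)) // ltnS size_exp mulnC leq_mul2r.
by rewrite leq_mul2l (ltnW (ltn_ord _)) !orbT.
Qed.

Hypothesis t_gt0 : (0 < t)%N.
Hypothesis f_coprime : forall i j, i != j -> coprimep (f i) (f j).

(** If two exponents of [f i] differ, cancelling the smaller power leaves [f i] dividing a product
    of polynomials coprime to it. *)
Lemma power_prod_inj : injective power_prod.
Proof.
move=> b b' e; apply/eqP; apply: contraTT isT; rewrite -[b == b']negbK => /negPn.
move=> ne; have [i nei] : exists i, b i != b' i.
  apply/existsP; apply: contraNT ne => /existsPn h; apply/eqP/ffunP => i.
  by apply/eqP; have := h i; rewrite negbK.
wlog lt : b b' e {ne nei} / (b i < b' i)%N.
  move=> H; move: nei; rewrite -val_eqE neq_ltn => /orP[]; first exact: H.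
  by apply: H.
have := e; rewrite /power_prod (bigD1 i) //= [in RHS](bigD1 i) //=.
rewrite -(subnK (ltnW lt)) mulnDr exprD [f i ^+ _ * f i ^+ _]mulrC -mulrA.
move/(mulfI (expf_neq0 _ (factor_neq0 i))) => e'.
have : coprimep (f i) (\prod_(j | j != i) f j ^+ (t * b j)).
  elim/big_rec: _ => [|j q ji IH]; first exact: coprimep1.
  by rewrite coprimepMr IH andbT coprimep_expr // f_coprime // eq_sym.
have e0 : (0 < t * (b' i - b i))%N by rewrite muln_gt0 t_gt0 subn_gt0.
rewrite e' -(prednK e0) exprS -mulrA coprimepMr coprimepp => /andP[/eqP h _].
by have := f_gt1 i; rewrite h.
Qed.
End Products.

(** * Linear systems and multiplicities of roots *)

Lemma underdetermined_system (F : fieldType) (X Y : finType) (m : X -> Y -> F) :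
  (#|Y| < #|X|)%N ->
  exists2 v : X -> F, exists x, v x != 0 &
    forall y, \sum_x v x * m x y = 0.
Proof.
move=> YX; pose M := \matrix_(i < #|X|, j < #|Y|) m (enum_val i) (enum_val j).
have : kermx M != 0.
  rewrite kermx_eq0 /row_free neq_ltn (leq_ltn_trans _ YX) //.
  exact: rank_leq_col.
case/rowV0Pn => v /sub_kermxP vM v0.
exists (fun x => v 0 (enum_rank x)).
  have [i vi] : exists i, v 0 i != 0.
    apply/existsP; apply: contraNT v0 => /existsPn h; apply/eqP/rowP => i.
    by rewrite mxE; apply/eqP; have := h i; rewrite negbK.
  by exists (enum_val i); rewrite enum_valK.
move=> y; have /rowP /(_ (enum_rank y)) := vM; rewrite !mxE => e.
rewrite -[RHS]e (reindex (@enum_val X X)) /=; last first.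
  by apply: onW_bij; exists enum_rank => z; rewrite ?enum_valK ?enum_rankK.
by apply: eq_bigr => i _; rewrite mxE enum_valK enum_rankK.
Qed.

(** Differentiation lowers the exact multiplicity of a root by one, unless [p] divides this
    multiplicity; a multiplicity of at most [n < p] is safe. *)
Lemma dvdp_of_deriv (F : fieldType) p x n (q : {poly F}) :
  p \in [pchar F] -> (n < p)%N -> root q x ->
  ('X - x%:P) ^+ n %| q^`() -> ('X - x%:P) ^+ n.+1 %| q.
Proof.
move=> pF np qx; have [->|q0] := eqVneq q 0; first by rewrite dvdp0.
have [m [r]] := multiplicity_XsubC q x; rewrite q0 /= => rx eq.
case: m => [|m] in eq *.
  by move: qx; rewrite eq expr0 mulr1 (negPf rx).
rewrite eq; have [nm _|mn] := leqP n m.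
  by rewrite dvdp_mull // dvdp_exp2l.
have -> : (r * ('X - x%:P) ^+ m.+1)^`()
    = ('X - x%:P) ^+ m * (r^`() * ('X - x%:P) + r *+ m.+1).
  by rewrite derivM deriv_exp derivXsubC /= exprS; ring.
move/(dvdp_trans (dvdp_exp2l ('X - x%:P) mn)); rewrite exprSr.
rewrite dvdp_mul2l ?expf_neq0 ?polyXsubC_eq0 // dvdp_XsubCl.
rewrite /root hornerD hornerMn hornerM hornerXsubC subrr mulr0 add0r.
rewrite -mulr_natr mulf_eq0 -/(root r x) (negPf rx) -(dvdn_pcharf pF) /=.
by rewrite gtnNdvd // (leq_ltn_trans mn).
Qed.

Lemma dvdp_of_iter_deriv (F : fieldType) p (a : {poly F}) x n (q : {poly F}) :
  p \in [pchar F] -> (n <= p)%N -> ~~ root a x ->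
  (forall i, (i < n)%N -> root (iter i (scaled_deriv a) q) x) ->
  ('X - x%:P) ^+ n %| q.
Proof.
move=> pF + ax; elim: n q => [|n IH] q np h; first by rewrite expr0 dvd1p.
apply: (dvdp_of_deriv pF np); first exact: (h 0%N).
rewrite -(@Gauss_dvdpr _ _ a); last first.
  by rewrite coprimep_expl // coprimep_sym coprimep_XsubC.
apply: IH => [|i ni]; first exact: ltnW.
by have := h i.+1 ni; rewrite iterSr.
Qed.

Lemma size_multiple_roots (F : fieldType) n (s : seq F) (q : {poly F}) :
  q != 0 -> uniq s -> (forall x, x \in s -> ('X - x%:P) ^+ n %| q) ->
  (size s * n < size q)%N.
Proof.
move=> q0 us dv; suff : (\prod_(x <- s) ('X - x%:P)) ^+ n %| q.
  move/dvdp_leq => /(_ q0); apply: leq_trans.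
  have nz : (\prod_(x <- s) ('X - x%:P)) ^+ n != 0.
    by rewrite expf_neq0 ?monic_neq0 ?monic_prod_XsubC.
  by rewrite -[leqRHS]prednK ?size_poly_gt0 // ltnS size_exp size_prod_XsubC.
elim: s us dv => [|x s IH] /=; first by rewrite big_nil expr1n dvd1p.
move=> /andP[xs us] dv; rewrite big_cons exprMn Gauss_dvdp.
  by rewrite dv ?mem_head // IH // => y ys; rewrite dv // inE ys orbT.
rewrite coprimep_expl // coprimep_expr // coprimep_sym coprimep_XsubC.
by rewrite root_prod_XsubC.
Qed.

(** * Stepanov's method for points where all [f i] are [t]-th roots of unity *)

Section Stepanov.
Variables (F : fieldType) (p K B t : nat) (f : 'I_K -> {poly F}) (S : seq F).
Hypothesis pF : p \in [pchar F].
Hypothesis f_gt1 : forall i, (1 < size (f i))%N.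
Hypothesis t_gt0 : (0 < t)%N.
Hypothesis f_coprime : forall i j, i != j -> coprimep (f i) (f j).
Hypothesis S_uniq : uniq S.
Hypothesis S_unity : forall x i, x \in S -> (f i).[x] ^+ t = 1.

Local Notation Delta := (total_degree f).
Local Notation psi := (@power_prod F K B t f).
Local Notation tw := (@twisted_deriv F K B t f).

Lemma horner_power_prod b x : x \in S -> (psi b).[x] = 1.
Proof.
move=> xS; rewrite horner_prod big1 // => i _.
by rewrite horner_exp exprM S_unity // expr1n.
Qed.

Lemma all_prod_Nroot x : x \in S -> ~~ root (all_prod f) x.
Proof.
move=> xS; rewrite /root horner_prod; apply/prodf_neq0 => i _.
apply: contra_eq_neq (S_unity i xS) => ->.
by rewrite expr0n gtn_eqF // eq_sym oner_neq0.
Qed.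

(** As [psi b] is 1 on [S], a twisted sum of low degree takes there the values of a derivative of
    the combination of high degree. *)
Lemma horner_sum_twisted (P : {ffun 'I_K -> 'I_B} -> {poly F}) n x :
  x \in S -> (\sum_b iter n (tw b) (P b)).[x]
           = (iter n (scaled_deriv (all_prod f)) (\sum_b psi b * P b)).[x].
Proof.
move=> xS; rewrite iter_scaled_deriv_sum !horner_sum; apply: eq_bigr => b _.
by rewrite iter_scaled_deriv_power // hornerM horner_power_prod // mul1r.
Qed.

(* Take a nontrivial relation with the fewest terms. Any proper subfamily of
   its terms is linearly independent, so if all the sums below vanished, the
   Wronskian would force the [psi b] in the relation to coincide. *)
Lemma relation_twisted_sum A (P : {ffun 'I_K -> 'I_B} -> {poly F}) :
  (forall b, (size (P b) <= A)%N) -> (A + t * B * Delta <= p)%N ->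
  (exists b, P b != 0) -> \sum_b psi b * P b = 0 ->
  exists2 Q : {ffun 'I_K -> 'I_B} -> {poly F},
    (forall b, (size (Q b) <= A)%N) /\ \sum_b psi b * Q b = 0 &
    exists2 n, (n < B ^ K)%N & \sum_b iter n (tw b) (Q b) != 0.
Proof.
move=> + Ap; pose supp (P' : {ffun 'I_K -> 'I_B} -> {poly F}) := [set b | P' b != 0].
have [m] := ubnP #|supp P|; elim: m => // m IH in P *.
rewrite ltnS => Tm szP [b0 Pb0] rel; pose T := supp P.
have b0T : b0 \in T by rewrite inE.
have relT (G : {ffun 'I_K -> 'I_B} -> {poly F} -> {poly F}) : (forall b, G b 0 = 0) ->
    \sum_b G b (P b) = \sum_(b in T) G b (P b).
  move=> G0; rewrite [RHS]big_mkcond; apply: eq_bigr => b _; rewrite inE.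
  by case: eqP => [->|] //=.
have cT : #|T :\ b0| = #|T|.-1 by rewrite (cardsD1 b0 T) b0T.
have T0 : (0 < #|T|)%N by apply/card_gt0P; exists b0.
have cTm : (#|T| <= B ^ K)%N.
  by apply: leq_trans (max_card _) _; rewrite card_ffun !card_ord.
have [/existsP[n hn]|/existsPn hn] :=
    boolP [exists n : 'I_#|T|.-1, \sum_b iter n (tw b) (P b) != 0].
  exists P => //; exists n => //.
  by apply: leq_trans (ltn_ord n) _; apply: leq_trans (leq_pred _) _.
(* [h b] stands for [W / psi b]: multiplying a vanishing twisted sum by [W] turns it into a relation
   between derivatives of the [psi b * P b]. *)
pose W := \prod_b psi b; pose h b := \prod_(b' | b' != b) psi b'.
have hW b : h b * psi b = W by rewrite /W (bigD1 b) //= mulrC.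
have hinj b b' : h b = h b' -> b = b'.
  move=> e; apply: (power_prod_inj f_gt1 t_gt0 f_coprime).
  apply: (@mulfI _ (h b)); last by rewrite hW e hW.
  by apply/prodf_neq0 => j _; apply: power_prod_neq0.
pose d := scaled_deriv (all_prod f); pose f0 b := psi b * P b.
have rel0 n : \sum_(b in T) iter n d (f0 b) = 0.
  rewrite -iter_scaled_deriv_sum -(relT (fun b q => psi b * q)) ?rel.
    by elim: n => //= n ->; rewrite /d /scaled_deriv deriv0 mulr0.
  by move=> b; rewrite mulr0.
have relh n : (n < #|T|.-1)%N -> \sum_(b in T) h b * iter n d (f0 b) = 0.
  move=> nT; have := hn (Ordinal nT); rewrite negbK /= => /eqP e.
  rewrite -[RHS](mulr0 W) -[in RHS]e (relT (fun b => iter n (tw b))); last first.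
    by move=> b; elim: n {nT e} => //= n ->;
       rewrite /twisted_deriv deriv0 !mulr0 addr0.
  rewrite mulr_sumr; apply: eq_bigr => b _.
  by rewrite iter_scaled_deriv_power // mulrA hW.
(* Subtracting [h b0] times the differentiated relation removes the term [b0]. The remaining
   [#|T|.-1] terms are thus linearly dependent, which gives the shorter relation [P']. *)
have [|||c [b bT cb] sumc] := @wronskian_kernel F p (all_prod f) _
  (T :\ b0) f0 (fun b => h b - h b0) pF (all_prod_neq0 f_gt1).
- move=> b _; apply: leq_trans Ap; apply: leq_trans (size_polyMleq _ _) _.
  rewrite -subn1 leq_subLR add1n -addnS addnC.
  by rewrite leq_add ?szP ?size_power_prod.
- move=> n; rewrite cT => nT.
  transitivity (\sum_(b in T) (h b - h b0) * iter n d (f0 b)).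
    rewrite [RHS](bigD1 b0) //= subrr mul0r add0r.
    by apply: eq_bigl => b; rewrite !inE andbC.
  under eq_bigr do rewrite mulrBl.
  by rewrite sumrB relh // -mulr_sumr rel0 mulr0 subr0.
- have [b bT] : exists b, b \in T :\ b0.
    apply/set0Pn; apply: contra_neq Pb0 => T1.
    have := rel; rewrite (relT (fun b q => psi b * q)) => [|b]; last exact: mulr0.
    rewrite (bigD1 b0) //= big1 ?addr0 => [|b /andP[bT bb0]].
      by move/eqP; rewrite mulf_eq0 (negPf (power_prod_neq0 _ f_gt1 _)) => /eqP.
    by have := finset.in_set0 b; rewrite -T1 in_setD1 bb0 bT.
  exists b => //; rewrite subr_eq0; apply: contraTneq bT => /hinj ->.
  by rewrite !inE eqxx.
pose P' b := if b \in T :\ b0 then c b *: P b else 0.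
have sP' : supp P' \subset T :\ b0.
  by apply/fintype.subsetP => b'; rewrite inE /P'; case: ifP => // _; rewrite eqxx.
apply: (IH P').
- by apply: leq_trans Tm; rewrite (leq_ltn_trans (subset_leq_card sP')) // cT prednK.
- move=> b'; rewrite /P'; case: ifP => _; last by rewrite size_poly0.
  exact: leq_trans (size_scale_leq _ _) (szP _).
- exists b; rewrite /P' bT scale_poly_eq0 (negPf cb) /=.
  by move: bT; rewrite !inE => /andP[].
rewrite -[RHS]sumc [RHS]big_mkcond; apply: eq_bigr => b' _; rewrite /P'.
by case: ifP => _; rewrite ?mulr0 // scalerAr.
Qed.

(** The nonzero twisted sum agrees on [S] with a derivative of the zero relation, so [S] consists of
    its roots. *)
Lemma card_le_of_relation A (P : {ffun 'I_K -> 'I_B} -> {poly F}) :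
  (forall b, (size (P b) <= A)%N) -> (A + t * B * Delta <= p)%N ->
  (exists b, P b != 0) -> \sum_b psi b * P b = 0 ->
  (size S <= A + B ^ K * Delta)%N.
Proof.
move=> szP Ap P0 rel.
have [Q [szQ relQ] [n nB Q0]] := relation_twisted_sum szP Ap P0 rel.
apply: leq_trans (ltnW (max_poly_roots Q0 _ S_uniq)) _.
  apply/allP => x xS; rewrite /root horner_sum_twisted // relQ.
  suff -> : iter n (scaled_deriv (all_prod f)) 0 = 0 by rewrite horner0.
  by elim: n {nB Q0} => //= n ->; rewrite /scaled_deriv deriv0 mulr0.
apply: leq_trans (size_sum _ _ _) _; apply/bigmax_leqP => b _.
apply: leq_trans (size_iter_twisted_deriv t f_gt1 _ _ _) _.
by rewrite leq_add ?szQ // leq_mul2r (ltnW nB) orbT.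
Qed.

Lemma stepanov_bound D :
  (D * Delta.+1 < B ^ K)%N -> (D + t * B * Delta <= p)%N ->
  (size S * D <= D + t * B * Delta)%N \/ (size S <= D + B ^ K * Delta)%N.
Proof.
case: (posnP D) => [->|D0] DB Dp; first by left; rewrite muln0.
pose X := ({ffun 'I_K -> 'I_B} * 'I_D)%type.
(* The unknowns are the [D] coefficients of each [P b]. The equations make the first [D] twisted
   sums vanish identically; each has at most [D * Delta.+1] coefficients. *)
pose Y := ('I_D * 'I_(D * Delta.+1))%type.
pose m (x : X) (y : Y) := (iter y.1 (tw x.1) 'X^(x.2))`_y.2.
have [|v [x0 vx0] vm] := @underdetermined_system F X Y m.
  by rewrite !card_prod card_ffun !card_ord mulnC ltn_pmul2r.
pose P b : {poly F} := \sum_(i < D) v (b, i) *: 'X^i.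
have PE b : P b = \poly_(i < D) (if insub i is Some j then v (b, j) else 0).
  by rewrite poly_def; apply: eq_bigr => i _; rewrite valK.
have szP b : (size (P b) <= D)%N by rewrite PE size_poly.
have P0 : exists b, P b != 0.
  exists x0.1; apply: contraNneq vx0 => /(congr1 (fun q : {poly F} => q`_x0.2)).
  by rewrite PE coef_poly ltn_ord valK coef0 -surjective_pairing => ->.
have tw0 n : (n < D)%N -> \sum_b iter n (tw b) (P b) = 0.
  move=> nD; apply/polyP => j; rewrite coef0.
  have [lt|ge] := ltnP j (D * Delta.+1); last first.
    rewrite nth_default //; apply: leq_trans ge.
    apply: leq_trans (size_sum _ _ _) _; apply/bigmax_leqP => b _.
    apply: leq_trans (size_iter_twisted_deriv t f_gt1 _ _ _) _.
    by rewrite mulnS leq_add ?szP // leq_mul2r (ltnW nD) orbT.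
  rewrite coef_sum -[RHS](vm (Ordinal nD, Ordinal lt)).
  rewrite (eq_bigr (fun b => \sum_i v (b, i) * m (b, i) (Ordinal nD, Ordinal lt))).
    by rewrite pair_bigA; apply: eq_bigr => -[].
  move=> b _; rewrite /P iter_twisted_deriv_sum coef_sum.
  by apply: eq_bigr => i _; rewrite coefZ.
have [rel|nz] := eqVneq (\sum_b psi b * P b) 0.
  by right; apply: card_le_of_relation rel.
left; rewrite -ltnS; apply: leq_trans (size_multiple_roots nz S_uniq _) _.
  move=> x xS; apply: (dvdp_of_iter_deriv pF _ (all_prod_Nroot xS)) => [|i iD].
    by apply: leq_trans Dp; apply: leq_addr.
  by rewrite /root -horner_sum_twisted // tw0 ?horner0.
apply: leq_trans (size_sum _ _ _) _; apply/bigmax_leqP => b _.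
apply: leq_trans (size_polyMleq _ _) _.
rewrite -subn1 leq_subLR add1n -addnS -addSn addnC.
by rewrite leq_add ?(leqW (szP b)) ?size_power_prod.
Qed.
End Stepanov.

(** * Iterates of a polynomial *)

Definition iter_poly (F : fieldType) (f : {poly F}) (n : nat) : {poly F} :=
  iter n (fun q => f \Po q) 'X.

Lemma horner_iter_poly (F : fieldType) (f : {poly F}) n x :
  (iter_poly f n).[x] = iter n (horner f) x.
Proof. by elim: n => [|n IH] /=; rewrite ?hornerX // horner_comp IH. Qed.

Lemma iter_polyD (F : fieldType) (f : {poly F}) m n :
  iter_poly f (m + n) = iter_poly f m \Po iter_poly f n.
Proof.
elim: m => [|m IH]; first by rewrite add0n comp_polyX.
by rewrite addSn /iter_poly /= -/(iter_poly f _) IH comp_polyA.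
Qed.

Lemma size_iter_poly (F : fieldType) (f : {poly F}) n :
  (size (iter_poly f n)).-1 = ((size f).-1 ^ n)%N.
Proof.
elim: n => [|n IH]; first by rewrite size_polyX.
by rewrite /iter_poly /= size_comp_poly -/(iter_poly f n) IH expnS.
Qed.

(** Modulo the [i]-th iterate, the [j]-th one is congruent to the constant obtained by applying [f]
    to 0 [j - i] times. *)
Lemma coprimep_iter_poly (F : fieldType) (f : {poly F}) (i j : nat) :
  (i < j)%N -> iter (j - i) (horner f) 0 != 0 ->
  coprimep (iter_poly f i) (iter_poly f j).
Proof.
move=> ij nz; rewrite -(subnK (ltnW ij)) iter_polyD.
set q := iter_poly f (j - i); set r := iter_poly f i.
have [s qs] : exists s, q = s * 'X + q.[0]%:P.
  have : root (q - q.[0]%:P) 0 by rewrite /root !hornerE subrr.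
  case/factor_theorem => s; rewrite subr0 => e.
  by exists s; rewrite -e subrK.
rewrite qs comp_poly_MXaddC coprimep_addl_mul.
have -> : q.[0]%:P = q.[0] *: 1 :> {poly F} by rewrite -mul_polyC mulr1.
by rewrite coprimepZr ?coprimep1 // /q horner_iter_poly.
Qed.

(** * Orbits, their groups and returns to 0 *)

Section Orbits.
Variables (p : nat) (f : {poly 'F_p}) (u : 'F_p).
Hypothesis p_prime : prime p.

Lemma poly_orbitD m n : poly_orbit f u (m + n) = poly_orbit f (poly_orbit f u n) m.
Proof. exact: iterD. Qed.

Lemma poly_orbit_lt_trajectory i j :
  (i < j)%N -> (j < trajectory_length f u)%N ->
  poly_orbit f u i != poly_orbit f u j.
Proof.
rewrite /trajectory_length; case: ex_minnP => T _ minT ij jT.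
apply: contraL jT => e; rewrite -leqNgt; apply: minT.
by apply/existsP; exists (Ordinal ij).
Qed.

Lemma poly_orbit_inj i j :
  (i < trajectory_length f u)%N -> (j < trajectory_length f u)%N ->
  poly_orbit f u i = poly_orbit f u j -> i = j.
Proof.
move=> iT jT e; apply/eqP; case: ltngtP => // ij.
  by have := poly_orbit_lt_trajectory ij jT; rewrite e eqxx.
by have := poly_orbit_lt_trajectory ij iT; rewrite e eqxx.
Qed.

(** For constant [f], [u_1 = u_2]. This settles the case excluded from the Stepanov argument, which
    needs nonconstant iterates. *)
Lemma trajectory_length_const : (size f <= 1)%N -> (trajectory_length f u <= 2)%N.
Proof.
move=> /size1_polyC fc; rewrite leqNgt; apply/negP => T3.
have := @poly_orbit_lt_trajectory 1 2 isT T3.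
by rewrite /poly_orbit /= fc !hornerC eqxx.
Qed.

Lemma poly_orbit_unity N n :
  (0 < n <= N)%N -> poly_orbit f u n != 0 ->
  poly_orbit f u n ^+ orbit_group_size f u N = 1.
Proof.
move=> /andP[n0 nN] nz; have un : poly_orbit f u n \is a GRing.unit.
  by rewrite unitfE.
pose x := FinRing.Unit un.
have xG : x \in orbit_group f u N.
  apply: mem_gen; rewrite inE; apply/existsP.
  by exists (Ordinal (nN : (n < N.+1)%N)); rewrite n0 /=.
by have := expg_cardG xG => /(congr1 val); rewrite FinRing.val_unitX.
Qed.

(* At most one of [u_1, ..., u_N] vanishes, and it leaves a run of half
   length. *)
Lemma nonzero_run N :
  (N < trajectory_length f u)%N ->
  exists a l, [/\ (N <= l.*2.+1)%N, (a + l <= N)%N &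
    forall n, (a < n <= a + l)%N -> poly_orbit f u n != 0].
Proof.
move=> NT; have [/existsP[n0 /eqP un0]|/existsPn h] :=
  boolP [exists n : 'I_N.+1, poly_orbit f u n == 0]; last first.
  exists 0%N, N; split=> // [|n /andP[_ nN]]; first by lia.
  exact: (h (Ordinal (nN : (n < N.+1)%N))).
have n0T : (n0 < trajectory_length f u)%N by apply: leq_ltn_trans NT; rewrite -ltnS.
have nz n : (n <= N)%N -> n <> n0 -> poly_orbit f u n != 0.
  move=> nN; apply: contra_notN => /eqP un.
  by apply: poly_orbit_inj; rewrite ?un0 // (leq_ltn_trans nN).
have n0N : (n0 <= N)%N by rewrite -ltnS.
have [h|h] := leqP N (n0.-1).*2.+1.
  by exists 0%N, n0.-1; split=> [||n ?] //; [lia | apply: nz; lia].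
by exists n0, (N - n0)%N; split=> [||n ?]; [lia | lia | apply: nz; lia].
Qed.

(** A return to 0 after [j] steps makes the orbit of 0 purely periodic with [j] as a period. *)
Lemma orbit_period_return (R : realType) k j :
  (k%:R%:E <= orbit_period f R 0%R)%E -> (0 < j < k)%N -> poly_orbit f 0 j != 0.
Proof.
move=> kP /andP[j0 jk]; apply/eqP => ret.
suff : (orbit_period f R 0%R <= j%:R%:E)%E.
  by move/(le_trans kP); rewrite lee_fin ler_nat leqNgt jk.
apply: ereal_inf_lbound; exists j => //; split=> // n.
by rewrite /poly_orbit iterD -!/(poly_orbit _ _ _) ret.
Qed.
End Orbits.

(** * Choice of parameters and the bound in integers *)

Lemma exists_max_root e t : (0 < e)%N -> (0 < t)%N ->
  exists2 B, (0 < B)%N & (B ^ e <= t < B.+1 ^ e)%N.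
Proof.
move=> e0 t0; have ex0 : exists B, (B ^ e <= t)%N by exists 1%N; rewrite exp1n.
have bd B : (B ^ e <= t)%N -> (B <= t)%N.
  apply: leq_trans; case: B => // B.
  by rewrite -{1}(expn1 B.+1) leq_pexp2l.
case: (ex_maxnP ex0 bd) => B Bt maxB; exists B.
  by apply: maxB; rewrite exp1n.
by rewrite Bt ltnNge; apply/negP => /maxB; rewrite ltnn.
Qed.

Lemma orbit_bound p (f : {poly 'F_p}) u N K d :
  prime p -> (0 < K)%N -> (1 < size f <= d.+1)%N ->
  (forall j, (0 < j < K)%N -> poly_orbit f 0 j != 0) ->
  (N < trajectory_length f u)%N ->
  let t := orbit_group_size f u N in
  forall B, let Delta := (\sum_(i < K) d ^ i)%N in
  let D := (B ^ K)%N in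
  let box := (Delta.+2 * B)%N in
  (0 < B)%N -> (D + t * box * Delta <= p)%N ->
  exists s, (N <= (s + K).*2.+1)%N /\
    ((s * D <= D + t * box * Delta)%N \/ (s <= D + box ^ K * Delta)%N).
Proof.
move=> p_prime K0 /andP[f1 fd] ret NT t B Delta D box B0 Dp.
pose fs (i : 'I_K) := iter_poly f i.
have szf i : (size (fs i)).-1 = ((size f).-1 ^ i)%N by apply: size_iter_poly.
have fs1 i : (1 < size (fs i))%N.
  have : (0 < (size (fs i)).-1)%N by rewrite szf expn_gt0 -ltnS prednK ?f1 // ltnW.
  by case: (size _) => [|[]].
have tD : (total_degree fs <= Delta)%N.
  apply: leq_sum => i _; rewrite szf; case: (val i) => [|j]; first by rewrite !expn0.
  by rewrite leq_exp2r // -ltnS prednK // ltnW.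
have [a [l [Nl alN nz]]] := nonzero_run p_prime NT.
(* Each chosen point and its next [K - 1] images stay in the nonzero run. If the run is too short,
   truncated subtraction makes [S] empty and the bound on [N] still holds. *)
pose S := [seq poly_orbit f u n | n <- iota a.+1 (l - K.-1)].
have SP x : x \in S -> exists2 n, (a < n <= a + (l - K.-1))%N & x = poly_orbit f u n.
  by case/mapP => n; rewrite mem_iota => h ->; exists n => //; lia.
have S_uniq : uniq S.
  rewrite map_inj_in_uniq ?iota_uniq // => i j; rewrite !mem_iota => hi hj.
  by apply: poly_orbit_inj; apply: leq_ltn_trans NT; lia.
have unity x (i : 'I_K) : x \in S -> (fs i).[x] ^+ t = 1.
  case/SP => n hn ->; rewrite horner_iter_poly -/(poly_orbit f _ _) -poly_orbitD.
  have iK := ltn_ord i.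
  by apply: poly_orbit_unity => //; [lia | apply: nz; lia].
have cop i j : i != j -> coprimep (fs i) (fs j).
  wlog ij : i j / (i < j)%N => [H|] ne.
    have := ne; rewrite -val_eqE neq_ltn => /orP[] ij; first exact: H.
    by rewrite coprimep_sym H // eq_sym.
  apply: coprimep_iter_poly => //; apply: ret; have := ltn_ord j; lia.
have t0 : (0 < t)%N by apply: cardG_gt0.
exists (size S); split.
  by rewrite size_map size_iota; lia.
have [||h|h] := @stepanov_bound _ p K box t fs S (pchar_Fp p_prime) fs1 t0 cop
  S_uniq unity D.
(* The factor [Delta.+2] in [box] serves to make [box ^ K] exceed [D * Delta.+1]. *)
- rewrite /D /box expnMn mulnC ltn_mul2r expn_gt0 B0 /=.
  apply: (@leq_trans Delta.+2); first by rewrite !ltnS.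
  by rewrite -{1}(expn1 Delta.+2) leq_pexp2l.
- by apply: leq_trans Dp; rewrite leq_add2l leq_mul2l tD orbT.
- by left; apply: leq_trans h _; rewrite leq_add2l leq_mul2l tD orbT.
- by right; apply: leq_trans h _; rewrite leq_add2l leq_mul2l tD orbT.
Qed.

(** [C4] serves when the degrees exceed [p]. The square is that of a constant [C6] with
    [N <= C6 * B ^ K]; exponent 2 suffices as [2K - 1 <= 2K]. *)
Definition group_size_const (K d : nat) : nat :=
  let Delta := (\sum_(i < K) d ^ i)%N in
  let C4 := (1 + Delta.+2 * Delta)%N in
  let C5 := (1 + 2 ^ (K.*2.-1) * Delta.+2 * Delta + Delta.+2 ^ K * Delta)%N in
  (C4 + (2 * C5 + 2 * K + 1) ^ 2)%N.

(** With [B] the integer part of [t^(1/(2K-1))], either [N = O(B^K)] or [p = O(t * B)]. Raising to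
    the power [2K - 1] removes [B]. *)
Lemma orbit_group_size_bound p (f : {poly 'F_p}) u N K d :
  prime p -> (0 < K)%N -> (1 < size f <= d.+1)%N ->
  (forall j, (0 < j < K)%N -> poly_orbit f 0 j != 0) ->
  (N < trajectory_length f u)%N ->
  let m := (group_size_const K d * orbit_group_size f u N)%N in
  (N ^ K.*2.-1 <= m ^ K)%N \/ (p ^ K.*2.-1 <= m ^ K.*2)%N.
Proof.
move=> p_prime K0 fd ret NT m; set t := orbit_group_size f u N in m *.
set e := K.*2.-1.
have e0 : (0 < e)%N by rewrite /e; lia.
have t0 : (0 < t)%N by apply: cardG_gt0.
have [B B0 /andP[Bt tB]] := exists_max_root e0 t0.
pose Delta := (\sum_(i < K) d ^ i)%N; pose D := (B ^ K)%N.
pose C4 := (1 + Delta.+2 * Delta)%N.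
pose C5 := (1 + 2 ^ e * Delta.+2 * Delta + Delta.+2 ^ K * Delta)%N.
pose C6 := (2 * C5 + 2 * K + 1)%N.
have mE : m = ((C4 + C6 ^ 2) * t)%N by [].
have D0 : (0 < D)%N by rewrite expn_gt0 B0.
(* From [t < (B + 1)^e <= (2B)^e] and [e + 1 = 2K]; this lets the bound on [s * D] be divided by
   [D]. *)
have tB2 : (t * B <= 2 ^ e * (D * D))%N.
  have -> : (2 ^ e * (D * D) = (2 * B) ^ e * B)%N.
    rewrite expnMn -mulnA -expnSr /D -expnD; congr (_ * B ^ _)%N.
    by rewrite /e; lia.
  rewrite leq_mul2r (ltnW (leq_trans tB _)) ?orbT // leq_exp2r //; lia.
have Dt : (D <= t * B)%N.
  apply: leq_trans (leq_pmulr _ B0); apply: leq_trans Bt.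
  by rewrite leq_pexp2l // /e; lia.
have [pD|pD] := leqP (D + t * (Delta.+2 * B) * Delta)%N p; last first.
  right; have pC : (p <= C4 * t * B)%N.
    apply: leq_trans (ltnW pD) _.
    rewrite -[leqRHS]mulnA /C4 [leqRHS]mulnDl mul1n leq_add //.
    by apply/eq_leq; ring.
  have -> : K.*2 = e.+1 by rewrite /e; lia.
  apply: (@leq_trans ((C4 * t * B) ^ e)); first by rewrite leq_exp2r.
  rewrite expnMn expnS mulnC leq_mul //.
    apply: leq_trans Bt _; rewrite mE; apply: leq_pmull.
    by rewrite /C4 add1n addSn.
  by rewrite leq_exp2r // mE leq_mul2r leq_addr orbT.
left; have [s [Ns hs]] := orbit_bound p_prime K0 fd ret NT B0 pD.
have sC : (s <= C5 * D)%N.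
  have C5D x : (C5 * x = x + 2 ^ e * x * (Delta.+2 * Delta) + Delta.+2 ^ K * x * Delta)%N.
    by rewrite /C5; ring.
  case: hs => hs; last first.
    by apply: leq_trans hs _; rewrite expnMn C5D leq_add // leq_addr.
  rewrite -(leq_pmul2r D0) -mulnA C5D; apply: leq_trans hs (leq_trans _ (leq_addr _ _)).
  have -> : (t * (Delta.+2 * B) * Delta = t * B * (Delta.+2 * Delta))%N by ring.
  by rewrite leq_add ?leq_pmulr // leq_mul2r tB2 orbT.
have NC : (N <= C6 * D)%N.
  apply: leq_trans Ns _; rewrite /C6; nia.
apply: (@leq_trans ((C6 * D) ^ e)); first by rewrite leq_exp2r.
have C6_0 : (0 < C6)%N by rewrite /C6 addn1.
apply: (@leq_trans ((C6 ^ 2 * t) ^ K)); last first.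
  by rewrite leq_exp2r // mE leq_mul2r leq_addl orbT.
rewrite (expnMn C6) (expnMn _ t) leq_mul //.
  by rewrite -(expnM C6) leq_pexp2l // /e; lia.
by rewrite /D -(expnM B) mulnC (expnM B) leq_exp2r.
Qed.

(** * Passage to real exponents *)

Lemma powR_le_of_expn (R : realType) (x m a b : nat) (e : R) :
  (0 < x)%N -> (0 < b)%N -> e * b%:R <= a%:R -> (x ^ a <= m ^ b)%N ->
  x%:R `^ e <= m%:R.
Proof.
move=> x0 b0 eb xm; have b0' : 0 < b%:R :> R by rewrite ltr0n.
have xa : e <= a%:R / b%:R by rewrite ler_pdivlMr.
apply: le_trans (ler_powR _ xa) _; first by rewrite ler1n.
have -> : m%:R = (m%:R ^+ b) `^ b%:R^-1 :> R.
  by rewrite -powR_mulrn // -powRrM mulfV ?gt_eqF // powRr1.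
rewrite powRrM powR_mulrn // ge0_ler_powR ?nnegrE ?invr_ge0 ?exprn_ge0 //.
by rewrite -!natrX ler_nat.
Qed.

Theorem corollary1p2 (R : realType) (eps : R) (d : nat) :
  0 < eps -> (2 <= d)%N ->
  exists c1 c2 : R, [/\ 0 < c1, 0 < c2 &
    forall (p : nat), prime p ->
    forall (f : {poly 'F_p}) (u : 'F_p) (N : nat),
      (size f <= d.+1)%N ->
      (c1%:E <= orbit_period f R 0%R)%E ->
      (1 <= N)%N -> (N < trajectory_length f u)%N ->
      c2 * Num.min (N%:R `^ (2 - eps)) (p%:R `^ (1 - eps))
        <= (orbit_group_size f u N)%:R].
Proof.
(* [K] exceeds [1 / eps], so the exponents [2 - 1/K] and [1 - 1/(2K)] are at least [2 - eps] and
   [1 - eps]. *)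
move=> eps0 d2; pose K := (Num.truncn eps^-1).+1; pose M := group_size_const K d.
have K0 : (0 < K)%N by [].
have M0 : (0 < M)%N by [].
have Ke : 1 <= eps * K%:R.
  by rewrite mulrC -ler_pdivrMr // mul1r ltW // truncnS_gt.
have M0' : 0 < M%:R :> R by rewrite ltr0n.
have M1 : M%:R^-1 <= 1 :> R by rewrite invf_le1 // ler1n.
(* A period of at least [K] keeps the orbit of 0 away from 0 during steps 1 to [K - 1], which makes
   the first [K] iterates coprime. *)
exists K%:R, M%:R^-1; split; [by rewrite ltr0n | by rewrite invr_gt0 |].
move=> p p_prime f u N fd cP N1 NT; set t := orbit_group_size f u N.
have [f1|f1] := leqP (size f) 1.
  have -> : N = 1%N by have := trajectory_length_const u f1; lia.
  rewrite powR1; apply: (@le_trans _ _ 1); last by rewrite ler1n cardG_gt0.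
  apply: (@le_trans _ _ (M%:R^-1 * 1)); last by rewrite mulr1.
  by rewrite ler_pM2l ?invr_gt0 // ge_min lexx.
rewrite mulrC ler_pdivrMr // -natrM mulnC ge_min.
have ret j : (0 < j < K)%N -> poly_orbit f 0 j != 0.
  exact: orbit_period_return cP.
have e2 : (K.*2.-1)%:R = 2 * K%:R - 1 :> R.
  by rewrite -subn1 natrB // -mul2n natrM.
have fd' : (1 < size f <= d.+1)%N by rewrite f1.
have [h|h] := orbit_group_size_bound p_prime K0 fd' ret NT.
  apply/orP; left; apply: powR_le_of_expn h => //.
  by rewrite e2 mulrBl lerB.
apply/orP; right; apply: powR_le_of_expn h => //; first exact: prime_gt0.
rewrite e2 mulrBl mul1r -mul2n natrM lerB // mulrCA.
by apply: (le_trans Ke); rewrite ler_peMl ?ler1n // mulr_ge0 // ltW.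
Qed.
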